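(* Let $\mathcal{G}$ be a class of graphs that is contained in the class of $P_4$-extendible graphs or contained in the class of $P_4$-sparse graphs, and that is closed under taking complements and under taking induced subgraphs. Let $G$ be a graph in $\mathcal{G}$. Then $G$ is a minimal unipolar obstruction if and only if $G$ is isomorphic to one of $2P_3$, $K_{2,3}$, $C_5$.
   Context: All graphs are simple and finite; graph classes are closed under isomorphism. $nH$ denotes the disjoint union of $n$ copies of $H$. A cluster is a disjoint union of complete graphs (equivalently, a $P_3$-free graph). A unipolar partition of a graph $G$ is a partition $(A,B)$ of its vertex set (parts may be empty) such that $A$ is a clique and $G[B]$ is a cluster; $G$ is unipolar if it has a unipolar partition. A minimal unipolar obstruction is a graph that is not unipolar but all of whose proper induced subgraphs are unipolar. ''A $P_4$'' of a graph means an induced path on four vertices. A graph is $P_4$-sparse if every set of five vertices induces at most one $P_4$. A graph is $P_4$-extendible if for every vertex subset $W$ inducing a $P_4$, there is at most one vertex $v\notin W$ that belongs to a $P_4$ sharing vertices with $W$. *)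

(* Defs.v *)
From mathcomp Require Import all_boot.

Set Implicit Arguments.
Unset Strict Implicit.
Unset Printing Implicit Defensive.

Record sgraph := SGraph {
  svertex :> finType;
  sedge : rel svertex;
  sedge_sym : symmetric sedge;
  sedge_irr : irreflexive sedge
}.

Notation "x -- y" := (sedge x y) (at level 30).

Definition sg_iso (G H : sgraph) : Prop :=
  exists2 f : G -> H, bijective f & forall x y : G, (f x -- f y) = (x -- y).

Section Operations.
Variable G : sgraph.

Definition compl_rel : rel G := fun x y => (x != y) && ~~ (x -- y).

Lemma compl_rel_sym : symmetric compl_rel.
Proof. by move=> x y; rewrite /compl_rel eq_sym sedge_sym. Qed.

Lemma compl_rel_irr : irreflexive compl_rel.
Proof. by move=> x; rewrite /compl_rel eqxx. Qed.

Definition sg_compl : sgraph := SGraph compl_rel_sym compl_rel_irr.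

Variable S : {set G}.

Definition induced_rel : rel {x | x \in S} := fun x y => val x -- val y.

Lemma induced_rel_sym : symmetric induced_rel.
Proof. by move=> x y; apply: sedge_sym. Qed.

Lemma induced_rel_irr : irreflexive induced_rel.
Proof. by move=> x; apply: sedge_irr. Qed.

Definition induced : sgraph := SGraph induced_rel_sym induced_rel_irr.

End Operations.

Section Copies.
Variables (n : nat) (H : sgraph).

Definition copies_rel : rel ('I_n * H) :=
  fun u v => (u.1 == v.1) && (u.2 -- v.2).

Lemma copies_rel_sym : symmetric copies_rel.
Proof. by move=> u v; rewrite /copies_rel eq_sym sedge_sym. Qed.

Lemma copies_rel_irr : irreflexive copies_rel.
Proof. by move=> u; rewrite /copies_rel sedge_irr andbF. Qed.

Definition copies : sgraph := SGraph copies_rel_sym copies_rel_irr.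

End Copies.

Section Families.
Variables m n : nat.

Definition path_rel : rel 'I_n := fun i j => (i.+1 == j) || (j.+1 == i).

Lemma path_rel_sym : symmetric path_rel.
Proof. by move=> i j; rewrite /path_rel orbC. Qed.

Lemma path_rel_irr : irreflexive path_rel.
Proof. by move=> i; rewrite /path_rel orbb; apply/eqP/nesym/n_Sn. Qed.

Definition path_graph : sgraph := SGraph path_rel_sym path_rel_irr.

(* The condition [i != j] only matters for the degenerate value n = 1. *)
Definition cycle_rel : rel 'I_n :=
  fun i j => (i != j) && ((i.+1 %% n == j) || (j.+1 %% n == i)).

Lemma cycle_rel_sym : symmetric cycle_rel.
Proof. by move=> i j; rewrite /cycle_rel eq_sym orbC. Qed.

Lemma cycle_rel_irr : irreflexive cycle_rel.
Proof. by move=> i; rewrite /cycle_rel eqxx. Qed.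

Definition cycle_graph : sgraph := SGraph cycle_rel_sym cycle_rel_irr.

Definition biclique_rel : rel ('I_m + 'I_n)%type := fun u v =>
  match u, v with
  | inl _, inr _ | inr _, inl _ => true
  | _, _ => false
  end.

Lemma biclique_rel_sym : symmetric biclique_rel.
Proof. by move=> [i|i] [j|j]. Qed.

Lemma biclique_rel_irr : irreflexive biclique_rel.
Proof. by move=> [i|i]. Qed.

Definition complete_bipartite : sgraph :=
  SGraph biclique_rel_sym biclique_rel_irr.

End Families.

Definition clique (G : sgraph) (A : {set G}) : Prop :=
  {in A &, forall x y : G, x != y -> x -- y}.

(* Disjoint union of complete graphs: the blocks of P are the vertex sets of
   the complete graphs. *)
Definition cluster (G : sgraph) : Prop :=
  exists2 P : {set {set G}}, partition P [set: G] &
    forall x y : G, (x -- y) = (x != y) && (pblock P x == pblock P y).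

(* [finset.partition] forbids empty blocks, which are allowed here. *)
Definition unipolar_partition (G : sgraph) (A B : {set G}) : Prop :=
  [/\ A :|: B = [set: G], A :&: B = set0, clique A & cluster (induced B)].

Definition unipolar (G : sgraph) : Prop :=
  exists A B : {set G}, unipolar_partition A B.

Definition minimal_unipolar_obstruction (G : sgraph) : Prop :=
  ~ unipolar G /\
  forall S : {set G}, S \proper [set: G] -> unipolar (induced S).

(* An induced path on four vertices is identified with its vertex set: a set
   inducing a P_4 is the vertex set of exactly one path. *)
Definition induces_P4 (G : sgraph) (W : {set G}) : Prop :=
  sg_iso (induced W) (path_graph 4).

Definition P4_sparse (G : sgraph) : Prop :=
  forall S : {set G}, #|S| = 5 ->
  forall W1 W2 : {set G}, W1 \subset S -> W2 \subset S ->
    induces_P4 W1 -> induces_P4 W2 -> W1 = W2.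

Definition extends_P4 (G : sgraph) (W : {set G}) (v : G) : Prop :=
  v \notin W /\
  exists U : {set G}, [/\ induces_P4 U, v \in U & U :&: W != set0].

Definition P4_extendible (G : sgraph) : Prop :=
  forall W : {set G}, induces_P4 W ->
  forall v w : G, extends_P4 W v -> extends_P4 W w -> v = w.

Definition iso_closed (C : sgraph -> Prop) : Prop :=
  forall G H : sgraph, sg_iso G H -> C G -> C H.

Definition compl_closed (C : sgraph -> Prop) : Prop :=
  forall G : sgraph, C G -> C (sg_compl G).

Definition hereditary (C : sgraph -> Prop) : Prop :=
  forall (G : sgraph) (S : {set G}), C G -> C (induced S).

(* Main.v *)
Require Import Defs.
From mathcomp Require Import all_boot.

(* Suppose all proper induced subgraphs of G are unipolar and G has no induced
   2P_3, K_{2,3} or C_5.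
   If G is a join of two graphs that are not complete, both sides have no
   independent set of size 3, and a unipolar graph with that property is covered
   by two cliques, hence so is G.  If G is disconnected, all but one part are
   clusters.  By Seinsche's theorem this settles the case without P_4.
   Otherwise, around a P_4 of G one finds a set X such that every vertex outside
   X sees all or none of X.  If X is not everything, then either G is a join, or
   the vertices seeing all of X and having no nonneighbour of that kind form a
   clique that can be added to the clique part of a smaller unipolar graph,
   while the vertices seeing none of X go to its cluster part.  If X is
   everything, G is a spider whose head is unipolar, or (in the extendible case)
   a P_4 with one more vertex x and with a set M of vertices that see just the
   midpoints of the P_4; then x has one of a few neighbourhoods in the P_4, and
   each of them gives an explicit partition. *)

Set Implicit Arguments.
Unset Strict Implicit.
Unset Printing Implicit Defensive.

(** * Unipolar graphs as two-colourings *)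

(* c colours the vertices of the clique part; the colouring is only
   constrained on S. *)
Definition unip (G : sgraph) (S : {set G}) : Prop :=
  exists c : pred G,
    {in S &, forall x y, c x -> c y -> x != y -> x -- y} /\
    {in S & &, forall x y z, ~~ c x -> ~~ c y -> ~~ c z ->
       x -- y -> y -- z -> x != z -> x -- z}.

Definition p3free (G : sgraph) (S : {set G}) : Prop :=
  {in S & &, forall x y z, x -- y -> y -- z -> x != z -> x -- z}.

Definition embedding (H G : sgraph) (f : H -> G) : Prop :=
  injective f /\ forall x y, f x -- f y = x -- y.

Lemma edge_neq (G : sgraph) (x y : G) : x -- y -> x != y.
Proof. by apply: contraTneq => ->; rewrite sedge_irr. Qed.

(** Without an induced P_3, being equal or adjacent is an equivalence relation, and its classes are
    the blocks. *)
Lemma cluster_p3free (G : sgraph) : cluster G <-> p3free [set: G].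
Proof.
split=> [[P _ eP] x y z _ _ _|p3].
  by rewrite !eP => /andP[_ /eqP->] /andP[_ /eqP->] ->; rewrite eqxx.
pose R : rel G := fun x y => (x == y) || x -- y.
have eqR : {in [set: G] & &, equivalence_rel R}.
  move=> x y z _ _ _; split; first by rewrite /R eqxx.
  rewrite /R => /orP[/eqP-> // | xy].
  have [<-|nxz] := eqVneq x z; first by rewrite sedge_sym xy orbT.
  have [<-|nyz] := eqVneq y z; first by rewrite xy.
  apply/idP/idP => /= [xz|yz]; last exact: (p3 x y z).
  by apply: (p3 y x z) => //; rewrite sedge_sym.
exists (equivalence_partition R [set: G]).
  exact: equivalence_partitionP.
move=> x y; rewrite (eq_pblock _ (x := x)).
- rewrite pblock_equivalence_partition //= /R.
  by have [->|//] := eqVneq x y; rewrite sedge_irr.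
- by case/and3P: (equivalence_partitionP eqR).
- by case/and3P: (equivalence_partitionP eqR) => /eqP->; rewrite inE.
Qed.

Lemma cluster_induced (G : sgraph) (S : {set G}) :
  cluster (induced S) <-> p3free S.
Proof.
split=> [/cluster_p3free p3 x y z xS yS zS xy yz nxz|p3].
  exact: (p3 (Sub x xS) (Sub y yS) (Sub z zS)).
apply/cluster_p3free => x y z _ _ _ xy yz nxz.
exact: (p3 (val x) (val y) (val z) (valP x) (valP y) (valP z)).
Qed.

Lemma unipolar_unip (G : sgraph) : unipolar G <-> unip [set: G].
Proof.
split=> [[A [B [AB _ cA /cluster_induced pB]]]|[c [cA pB]]].
  have inB x : x \notin A -> x \in B.
    by have := in_setT x; rewrite -AB inE => /orP[->|].
  exists (mem A); split=> [x y _ _ |x y z _ _ _ /inB xB /inB yB /inB]; first exact: cA.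
  by move: x y z xB yB; apply: pB.
exists [set x | c x], [set x | ~~ c x]; split.
- by apply/setP => x; rewrite !inE orbN.
- by apply/setP => x; rewrite !inE andbN.
- by move=> x y; rewrite !inE => cx cy; apply: cA; rewrite ?inE.
- by apply/cluster_induced => x y z; rewrite !inE => cx cy cz; apply: pB; rewrite ?inE.
Qed.

Lemma unip_embedding (H G : sgraph) (f : H -> G) (S : {set G}) :
  embedding f -> (forall x, f x \in S) -> unip S -> unipolar H.
Proof.
move=> [injf ef] fS [c [cA pB]]; apply/unipolar_unip; exists (c \o f); split.
  by move=> x y _ _ /= cx cy nxy; rewrite -ef; apply: cA; rewrite ?(inj_eq injf).
move=> x y z _ _ _ /= cx cy cz; rewrite -!ef => xy yz nxz.
by apply: (pB (f x) (f y) (f z)); rewrite ?(inj_eq injf).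
Qed.

Lemma val_embedding (G : sgraph) (S : {set G}) :
  embedding (val : induced S -> G).
Proof. by split=> //; apply: val_inj. Qed.

Lemma unip_induced (G : sgraph) (S : {set G}) :
  unipolar (induced S) <-> unip S.
Proof.
split; last by move=> uS; apply: (unip_embedding (val_embedding S)) uS => x; apply: valP.
move=> /unipolar_unip[c [cA pB]].
(* [insub] carries the colouring from the subtype to [G]; the default [false] is met only outside
   [S], where nothing is required. *)
exists (fun x => if insub x is Some u then c (u : induced S) else false); split.
  move=> x y xS yS; rewrite !insubT => cx cy nxy.
  exact: (cA (Sub x xS) (Sub y yS)).
move=> x y z xS yS zS; rewrite !insubT => cx cy cz xy yz nxz.
exact: (pB (Sub x xS) (Sub y yS) (Sub z zS)).
Qed.

Lemma sg_iso_sym (G H : sgraph) : sg_iso G H -> sg_iso H G.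
Proof.
move=> [f [g fK gK] ef]; exists g; first by exists f.
by move=> x y; rewrite -ef !gK.
Qed.

Lemma induced_image_iso (H G : sgraph) (f : H -> G) :
  embedding f -> sg_iso (induced (f @: [set: H])) H.
Proof.
move=> [injf ef]; apply: sg_iso_sym.
have fP x : f x \in f @: [set: H] by apply: imset_f.
exists (fun x => Sub (f x) (fP x) : induced (f @: [set: H])) => //.
apply: inj_card_bij => [x y /(congr1 val)/injf //|].
by rewrite card_sig card_imset // cardsT.
Qed.

(** If the copy of [H] missed a vertex of [G], it would lie in a proper induced subgraph, and
    pulling back a colouring would make [H] unipolar. So [f] is onto. *)
Lemma minimal_obstruction_iso (H G : sgraph) (f : H -> G) :
  embedding f -> ~ unipolar H -> minimal_unipolar_obstruction G -> sg_iso G H.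
Proof.
move=> embf nH [_ minG]; have [injf ef] := embf; apply: sg_iso_sym.
exists f => //; apply: inj_card_bij => //.
rewrite -(cardsT H) -(card_imset _ injf) leqNgt; apply/negP => lt.
apply: nH; apply: (unip_embedding (S := f @: [set: H]) embf).
  by move=> x; apply: imset_f.
apply/unip_induced/minG; rewrite properEcard subsetT cardsT.
exact: lt.
Qed.

(** Every proper induced subgraph of [G] embeds in [H] minus one vertex, so only vertex-deleted
    subgraphs have to be checked. *)
Lemma minimal_obstruction_of_iso (G H : sgraph) :
  sg_iso G H -> ~ unipolar H -> (forall u : H, unip [set~ u]) ->
  minimal_unipolar_obstruction G.
Proof.
move=> [f bijf ef] nH delH; have injf := bij_inj bijf; split.
  move=> /unipolar_unip uG; apply: nH.
  have [g injg eg] := sg_iso_sym (ex_intro2 _ _ f bijf ef).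
  by apply: (unip_embedding (f := g) _ _ uG) => [|x]; [split; first exact: bij_inj|rewrite inE].
move=> S /properP[_ [v _ vS]].
apply: (unip_embedding (f := f \o val : induced S -> H) _ _ (delH (f v))).
  by split=> [|x y] /=; [apply: inj_comp => //; apply: val_inj|rewrite ef].
move=> x; rewrite !inE /= (inj_eq injf).
by apply: contraNneq vS => <-; apply: valP.
Qed.

(** * The three obstructions *)

(** These Boolean clauses, instantiated at the vertices of a small graph, can be refuted by running
    through the values of [c]. *)
Lemma unip_colouring (G : sgraph) : unip [set: G] -> exists c : pred G,
  (forall x y, x != y -> ~~ (x -- y) -> ~~ (c x && c y)) /\
  (forall x y z, x != z -> x -- y -> y -- z -> ~~ (x -- z) -> [|| c x, c y | c z]).
Proof.
move=> [c [cA pB]]; exists c; split=> [x y nxy|x y z nxz xy yz].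
  by apply: contra => /andP[cx cy]; apply: cA; rewrite ?inE.
apply: contraR; rewrite !negb_or => /and3P[cx cy cz].
by apply: (pB x y z); rewrite ?inE.
Qed.

Lemma cycle5_not_unipolar : ~ unipolar (cycle_graph 5).
Proof.
move=> /unipolar_unip/unip_colouring[c [cA pB]].
pose o k (lt : k < 5) : cycle_graph 5 := Ordinal lt.
have := cA (o 0 isT) (o 2 isT) isT isT.
have := cA (o 1 isT) (o 3 isT) isT isT.
have := cA (o 2 isT) (o 4 isT) isT isT.
have := cA (o 3 isT) (o 0 isT) isT isT.
have := cA (o 4 isT) (o 1 isT) isT isT.
have := pB (o 0 isT) (o 1 isT) (o 2 isT) isT isT isT isT.
have := pB (o 1 isT) (o 2 isT) (o 3 isT) isT isT isT isT.
have := pB (o 2 isT) (o 3 isT) (o 4 isT) isT isT isT isT.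
have := pB (o 3 isT) (o 4 isT) (o 0 isT) isT isT isT isT.
have := pB (o 4 isT) (o 0 isT) (o 1 isT) isT isT isT isT.
by case: (c _); case: (c _); case: (c _); case: (c _); case: (c _).
Qed.

Lemma cycle5_delete_unip (u : cycle_graph 5) : unip [set~ u].
Proof.
(* The clique is the edge opposite to [u]; the two neighbours of [u] remain and are nonadjacent. *)
exists (fun v : 'I_5 => (v == (u + 2) %% 5 :> nat) || (v == (u + 3) %% 5 :> nat)).
split=> [x y|x y z]; rewrite !inE.
  by case: u x y => [] [|[|[|[|[|//]]]]] ? [[|[|[|[|[|//]]]]] ?] //;
    case=> [] [|[|[|[|[|//]]]]].
by case: u x y z => [] [|[|[|[|[|//]]]]] ? [[|[|[|[|[|//]]]]] ?] //;
  case=> [] [|[|[|[|[|//]]]]] ? //; case=> [] [|[|[|[|[|//]]]]].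
Qed.

Lemma biclique23_not_unipolar : ~ unipolar (complete_bipartite 2 3).
Proof.
move=> /unipolar_unip/unip_colouring[c [cA pB]].
pose l k (lt : k < 2) : complete_bipartite 2 3 := inl (Ordinal lt).
pose r k (lt : k < 3) : complete_bipartite 2 3 := inr (Ordinal lt).
have := cA (l 0 isT) (l 1 isT) isT isT.
have := cA (r 0 isT) (r 1 isT) isT isT.
have := cA (r 0 isT) (r 2 isT) isT isT.
have := cA (r 1 isT) (r 2 isT) isT isT.
have := pB (r 0 isT) (l 0 isT) (r 1 isT) isT isT isT isT.
have := pB (r 0 isT) (l 1 isT) (r 1 isT) isT isT isT isT.
have := pB (r 0 isT) (l 0 isT) (r 2 isT) isT isT isT isT.
have := pB (r 0 isT) (l 1 isT) (r 2 isT) isT isT isT isT.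
have := pB (r 1 isT) (l 0 isT) (r 2 isT) isT isT isT isT.
have := pB (r 1 isT) (l 1 isT) (r 2 isT) isT isT isT isT.
by case: (c _); case: (c _); case: (c _); case: (c _); case: (c _).
Qed.

Lemma biclique23_delete_unip (u : complete_bipartite 2 3) : unip [set~ u].
Proof.
(* If [u] is on the left, the clique is the other left vertex. If [u] is on the right, the clique is
   an edge, and the two vertices left over form an edge too. *)
exists (fun v : 'I_2 + 'I_3 => match u, v with
  | inl i, inl j => true
  | inr i, inr j => j == (i + 1) %% 3 :> nat
  | inr i, inl j => j == 0 :> nat
  | _, _ => false
  end).
split=> [x y|x y z]; rewrite !inE.
  by case: u x y => [] [] [|[|[|//]]] ? // [] [[|[|[|//]]] ?] //
    [] [[|[|[|//]]] ?].
by case: u x y z => [] [] [|[|[|//]]] ? // [] [[|[|[|//]]] ?] //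
  [] [[|[|[|//]]] ?] // [] [[|[|[|//]]] ?].
Qed.

Lemma two_path3_not_unipolar : ~ unipolar (copies 2 (path_graph 3)).
Proof.
move=> /unipolar_unip/unip_colouring[c [cA pB]].
pose o i k (lti : i < 2) (lt : k < 3) : copies 2 (path_graph 3) :=
  (Ordinal lti, Ordinal lt).
have cross i j (lti : i < 3) (ltj : j < 3) :
    ~~ (c (o 0 _ isT lti) && c (o 1 _ isT ltj)) by apply: cA.
have := pB (o 0 0 isT isT) (o 0 1 isT isT) (o 0 2 isT isT) isT isT isT isT.
have := pB (o 1 0 isT isT) (o 1 1 isT isT) (o 1 2 isT isT) isT isT isT isT.
have := cross 0 0 isT isT; have := cross 0 1 isT isT; have := cross 0 2 isT isT.
have := cross 1 0 isT isT; have := cross 1 1 isT isT; have := cross 1 2 isT isT.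
have := cross 2 0 isT isT; have := cross 2 1 isT isT; have := cross 2 2 isT isT.
by case: (c _); case: (c _); case: (c _); case: (c _); case: (c _); case: (c _).
Qed.

Lemma two_path3_delete_unip (u : copies 2 (path_graph 3)) : unip [set~ u].
Proof.
(* The clique is the first edge of the copy without [u]; at most one vertex of that copy and two of
   the other copy remain. *)
exists (fun v : 'I_2 * 'I_3 => (v.1 != u.1) && (v.2 < 2)).
split=> [x y|x y z]; rewrite !inE.
  by case: u x y => [] [[|[|//]] ?] [[|[|[|//]]] ?]
    [[[|[|//]] ?] [[|[|[|//]]] ?]] [[[|[|//]] ?] [[|[|[|//]]] ?]].
by case: u x y z => [] [[|[|//]] ?] [[|[|[|//]]] ?]
  [[[|[|//]] ?] [[|[|[|//]]] ?]] // [[[|[|//]] ?] [[|[|[|//]]] ?]] //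
  [[[|[|//]] ?] [[|[|[|//]]] ?]].
Qed.

(** Here and in the next two definitions, distinctness is demanded only where the adjacencies do not
    force it. *)
Definition biclique23_free (G : sgraph) : Prop := forall x1 x2 y1 y2 y3 : G,
  x1 != x2 -> uniq [:: y1; y2; y3] ->
  x1 -- y1 -> x1 -- y2 -> x1 -- y3 -> x2 -- y1 -> x2 -- y2 -> x2 -- y3 ->
  ~~ (x1 -- x2) -> ~~ (y1 -- y2) -> ~~ (y1 -- y3) -> ~~ (y2 -- y3) -> False.

Definition two_path3_free (G : sgraph) : Prop := forall a b c a' b' c' : G,
  a != c -> a' != c' -> a -- b -> b -- c -> ~~ (a -- c) ->
  a' -- b' -> b' -- c' -> ~~ (a' -- c') ->
  {in [:: a; b; c] & [:: a'; b'; c'], forall x y, ~~ (x -- y)} -> False.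

Definition cycle5_free (G : sgraph) : Prop := forall a b c d x : G,
  a -- b -> b -- c -> c -- d -> d -- x -> x -- a ->
  ~~ (a -- c) -> ~~ (a -- d) -> ~~ (b -- d) -> ~~ (b -- x) -> ~~ (c -- x) ->
  False.

Lemma injective_neq (T U : eqType) (f : T -> U) :
  (forall x y, x != y -> f x != f y) -> injective f.
Proof. by move=> ne x y; apply: contra_eq; apply: ne. Qed.

Lemma minimal_biclique23_free (G : sgraph) :
  minimal_unipolar_obstruction G -> ~ sg_iso G (complete_bipartite 2 3) ->
  biclique23_free G.
Proof.
move=> minG nI x1 x2 y1 y2 y3 nx /= uy e11 e12 e13 e21 e22 e23 nx12 ny12 ny13 ny23.
pose f (u : 'I_2 + 'I_3) := match u with
  | inl i => nth x1 [:: x1; x2] i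
  | inr i => nth x1 [:: y1; y2; y3] i
  end.
apply/nI/(@minimal_obstruction_iso (complete_bipartite 2 3) _ f) => //;
  last exact: biclique23_not_unipolar.
split.
  apply: injective_neq => x y.
  move: uy; rewrite !inE negb_or => /and3P[/andP[n12 n13] n23 _].
  have [d11 d12 d13] := And3 (edge_neq e11) (edge_neq e12) (edge_neq e13).
  have [d21 d22 d23] := And3 (edge_neq e21) (edge_neq e22) (edge_neq e23).
  by case: x y => [] [] [|[|[|//]]] ? // [] [[|[|[|//]]] ?] //= _; rewrite // eq_sym.
move: nx12 ny12 ny13 ny23 => /negbTE nx12 /negbTE ny12 /negbTE ny13 /negbTE ny23.
by case=> [] [] [|[|[|//]]] ? // [] [[|[|[|//]]] ?] //=;
  rewrite ?sedge_irr // sedge_sym.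
Qed.

Lemma minimal_two_path3_free (G : sgraph) :
  minimal_unipolar_obstruction G -> ~ sg_iso G (copies 2 (path_graph 3)) ->
  two_path3_free G.
Proof.
move=> minG nI a b c a' b' c' nac nac' ab bc /negbTE ac ab' bc' /negbTE ac' cross.
pose f (u : 'I_2 * 'I_3) := nth a (nth [::] [:: [:: a; b; c]; [:: a'; b'; c']] u.1) u.2.
have {}cross i j : i < 3 -> j < 3 ->
    nth a [:: a; b; c] i -- nth a [:: a'; b'; c'] j = false.
  by move=> lti ltj; apply/negbTE/cross; apply: mem_nth.
have [aa ab1 ac1] := And3 (cross 0 0 isT isT) (cross 0 1 isT isT) (cross 0 2 isT isT).
have [ba bb bc1] := And3 (cross 1 0 isT isT) (cross 1 1 isT isT) (cross 1 2 isT isT).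
have [ca cb cc] := And3 (cross 2 0 isT isT) (cross 2 1 isT isT) (cross 2 2 isT isT).
rewrite /= in aa ab1 ac1 ba bb bc1 ca cb cc.
apply/nI/(@minimal_obstruction_iso (copies 2 (path_graph 3)) _ f) => //;
  last exact: two_path3_not_unipolar.
split.
  apply: injective_neq => x y.
  have [d1 d2 d3 d4] := And4 (edge_neq ab) (edge_neq bc) (edge_neq ab') (edge_neq bc').
  (* A vertex of one path has a neighbour on that path, whereas a vertex of the other path sees
     nothing there; so the paths are disjoint. *)
  have daa : a != a' by apply: contraFneq ab1 => ->.
  have dab : a != b' by apply: contraFneq aa => ->; rewrite sedge_sym.
  have dac : a != c' by apply: contraFneq ab1 => ->; rewrite sedge_sym.
  have dba : b != a' by apply: contraFneq aa => <-.
  have dbb : b != b' by apply: contraFneq ab1 => <-.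
  have dbc : b != c' by apply: contraFneq ac1 => <-.
  have dca : c != a' by apply: contraFneq cb => ->.
  have dcb : c != b' by apply: contraFneq ca => ->; rewrite sedge_sym.
  have dcc : c != c' by apply: contraFneq cb => ->; rewrite sedge_sym.
  by case: x y => [] [[|[|//]] ?] [[|[|[|//]]] ?] [[[|[|//]] ?] [[|[|[|//]]] ?]] //= _;
    rewrite // eq_sym.
by case=> [] [[|[|//]] ?] [[|[|[|//]]] ?] [[[|[|//]] ?] [[|[|[|//]]] ?]] //=;
  rewrite ?sedge_irr // sedge_sym.
Qed.

Lemma minimal_cycle5_free (G : sgraph) :
  minimal_unipolar_obstruction G -> ~ sg_iso G (cycle_graph 5) -> cycle5_free G.
Proof.
move=> minG nI a b c d x ab bc cd dx xa /negbTE ac /negbTE ad /negbTE bd /negbTE bx /negbTE cx.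
pose f (i : 'I_5) := nth a [:: a; b; c; d; x] i.
apply/nI/(@minimal_obstruction_iso (cycle_graph 5) _ f) => //;
  last exact: cycle5_not_unipolar.
split.
  apply: injective_neq.
  have [dab dbc dcd] := And3 (edge_neq ab) (edge_neq bc) (edge_neq cd).
  have [ddx dxa] := conj (edge_neq dx) (edge_neq xa).
  have dac : a != c by apply: contraFneq ad => ->.
  have dad : a != d by apply: contraFneq ac => ->; rewrite sedge_sym.
  have dbd : b != d by apply: contraFneq bx => ->.
  have dbx : b != x by apply: contraFneq bd => ->; rewrite sedge_sym.
  have dcx : c != x by apply: contraFneq ac => ->; rewrite sedge_sym.
  by case=> [] [|[|[|[|[|//]]]]] ? [[|[|[|[|[|//]]]]] ?] //= _; rewrite // eq_sym.
by case=> [] [|[|[|[|[|//]]]]] ? [[|[|[|[|[|//]]]]] ?] //=;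
  rewrite ?sedge_irr // sedge_sym.
Qed.

(** * Joins, disjoint unions and modules *)

Lemma setT_or_notin (T : finType) (S : {set T}) :
  S = [set: T] \/ exists v, v \notin S.
Proof.
have [->|] := eqVneq S [set: T]; first by left.
by rewrite -subTset => /subsetPn[v _ vS]; right; exists v.
Qed.

(* K and S are the body and the legs of a generalised spider with head M;
   overlaps between the three sets are harmless. *)
Lemma spider_unip (G : sgraph) (K S M : {set G}) :
  (forall v, [|| v \in K, v \in S | v \in M]) ->
  clique K -> p3free S -> {in K & M, forall x y, x != y -> x -- y} ->
  {in S & M, forall x y, ~~ (x -- y)} -> unip M -> unip [set: G].
Proof.
move=> cover cK pS KM SM [c [cA pB]].
exists (fun v => (v \in K) || (v \notin S) && c v); split.
  have inM v : v \notin K -> v \notin S -> v \in M.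
    by move=> /negbTE vK /negbTE vS; have := cover v; rewrite vK vS.
  move=> x y _ _; case: (boolP (x \in K)) => [xK _|xK /= /andP[xS cx]];
    case: (boolP (y \in K)) => [yK _|yK /= /andP[yS cy]] nxy.
  - exact: cK.
  - exact/KM/nxy/inM.
  - by rewrite sedge_sym; apply: KM; rewrite // ?inM // eq_sym.
  - exact/cA/nxy/cy/cx/inM/yS/yK/inM.
have inSM v : ~~ ((v \in K) || (v \notin S) && c v) ->
    (v \in S) || (v \in M) && ~~ c v.
  rewrite negb_or negb_and negbK => /andP[vK /orP[->//|cv]].
  by have := cover v; rewrite (negbTE vK) cv andbT.
move=> x y z _ _ _ /inSM hx /inSM hy /inSM hz xy yz nxz.
have SS u v : u -- v -> u \in S -> (v \in S) || (v \in M) && ~~ c v -> v \in S.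
  by move=> uv uS /orP[//|/andP[vM _]]; have := SM _ _ uS vM; rewrite uv.
case: (boolP (y \in S)) => yS.
  apply: (pS x y z) => //; last exact: (SS y).
  by apply: (SS y); rewrite // sedge_sym.
have xS : x \notin S by apply: contra yS => xS; apply: (SS x).
have zS : z \notin S by apply: contra yS => zS; apply: (SS z); rewrite // sedge_sym.
move: hx hy hz; rewrite (negbTE xS) (negbTE yS) (negbTE zS) /=.
by move=> /andP[xM cx] /andP[yM cy] /andP[zM cz]; apply: (pB x y z).
Qed.

Definition triad_free (G : sgraph) (S : {set G}) : Prop :=
  {in S & &, forall x y z, x != y -> y != z -> x != z ->
     [|| x -- y, y -- z | x -- z]}.

(* Without independent triples, a block B of the cluster and the vertices of the
   clique that see all of B form one clique; all other vertices form another. *)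
Lemma unip_two_cliques (G : sgraph) (S : {set G}) :
  unip S -> triad_free S -> exists q : pred G,
    {in S &, forall x y, q x = q y -> x != y -> x -- y}.
Proof.
move=> [c [cA pB]] tri.
case: (pickP [pred b in S | ~~ c b]) => [b /andP[bS cb]|none]; last first.
  exists (fun=> true) => x y xS yS _; apply: cA => //.
    by have := none x; rewrite /= xS => /negbFE.
  by have := none y; rewrite /= yS => /negbFE.
pose B := [set y in S | ~~ c y & (y == b) || y -- b].
have BP y z : y \in S -> ~~ c y -> z \in B -> y != z -> y -- z -> y \in B.
  rewrite !inE => yS cy /and3P[zS cz /orP[/eqP->|zb]] nyz yz; apply/and3P; split=> //.
    by rewrite yz orbT.
  by have [//|nyb] := eqVneq y b; apply: (pB y z b).
pose q x := if c x then [forall y in B, (x != y) ==> x -- y] else x \in B.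
have cB y : y \in B -> ~~ c y by rewrite inE => /and3P[].
have SB y : y \in B -> y \in S by rewrite inE => /and3P[].
have bB : b \in B by rewrite inE bS cb eqxx.
(* If [y] is in [B], then [q x] says that [x] sees all of [B]. Otherwise [x] misses some [z] in [B];
   as [y] and [z] lie in different blocks, the triple [x], [y], [z] forces [x -- y]. *)
have mixed x y : x \in S -> y \in S -> c x -> ~~ c y -> q x = q y -> x -- y.
  move=> xS yS cx cy; rewrite /q cx (negbTE cy).
  have nxy : x != y by apply: contraNneq cy => <-.
  case: (boolP (y \in B)) => yB.
    by move/forall_inP/(_ y yB)/implyP; apply.
  move=> /negbT; rewrite negb_forall_in => /exists_inP[z zB].
  rewrite negb_imply => /andP[nxz xz].
  have nyz : y != z by apply: contraNneq yB => ->.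
  have yz : ~~ (y -- z) by apply: contra yB => yz; apply: (BP _ z).
  have := tri x y z xS yS (SB _ zB) nxy nyz nxz.
  by rewrite (negbTE yz) (negbTE xz) !orbF.
exists q => x y xS yS qxy nxy.
case cx: (c x); case cy: (c y).
- exact: cA.
- by apply: mixed => //; rewrite cy.
- by rewrite sedge_sym; apply: mixed => //; rewrite cx.
move: qxy; rewrite /q cx cy; case: (boolP (x \in B)) => xB yB.
  move: xB yB; rewrite [y \in B]inE !inE => /and3P[_ _ xb] /esym/and3P[_ _ yb].
  move/orP: xb => [/eqP xb|xb]; move/orP: yb => [/eqP yb|yb].
  - by rewrite xb yb eqxx in nxy.
  - by rewrite xb sedge_sym.
  - by rewrite yb.
  - by apply: (pB x b y); rewrite ?cx ?cy // sedge_sym.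
have nxb : x != b by apply: contraNneq xB => ->.
have nyb : y != b by apply: contraFneq (esym yB) => ->.
have xb : ~~ (x -- b) by apply: contra xB; apply: BP; rewrite ?cx.
have yb : ~~ (y -- b).
  by apply: contraFN (esym yB); apply: BP; rewrite ?cy.
have := tri x y b xS yS bS nxy nyb nxb.
by rewrite (negbTE xb) (negbTE yb) !orbF.
Qed.

Section Minimal.

Variable G : sgraph.
Hypothesis proper_unip : forall (S : {set G}) v, v \notin S -> unip S.
Hypothesis K23_free : biclique23_free G.
Hypothesis P3P3_free : two_path3_free G.

(** A side that is a clique can be added to the clique part of the other side. Otherwise each side
    has a nonadjacent pair, so K_{2,3}-freeness bans independent triples from both sides. Then each
    side is covered by two cliques, and these combine across the join into two cliques covering
    [G]. *)
Lemma join_unip (S : {set G}) x0 y0 : x0 \in S -> y0 \notin S ->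
  (forall x y, x \in S -> y \notin S -> x -- y) -> unip [set: G].
Proof.
move=> x0S y0S join.
have uS := proper_unip y0S.
have uSC : unip (~: S) by apply: (@proper_unip _ x0); rewrite inE x0S.
have split_clique (A B : {set G}) : (forall v, (v \in A) || (v \in B)) ->
    {in A & B, forall x y, x -- y} -> clique A -> unip B -> unip [set: G].
  move=> AB eAB cA uB; apply: (@spider_unip _ A set0 B) => //.
  - by move=> v; rewrite inE.
  - by move=> x y z; rewrite inE.
  - by move=> x y xA yB _; apply: eAB.
  - by move=> x y; rewrite inE.
have triad (A B : {set G}) : {in A & B, forall x y, x -- y} ->
    ~ clique A -> triad_free B.
  move=> eAB ncA x y z xB yB zB nxy nyz nxz.
  case: (boolP (_ || _)) => // /[!negb_or] /and3P[xy yz xz]; case: ncA => u v uA vA nuv.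
  case: (boolP (u -- v)) => // uv.
  exfalso; apply: (@K23_free u v x y z nuv) => //=; try exact: eAB.
  by rewrite !inE negb_or nxy nyz nxz.
have cliqueP : forall A : {set G}, clique A \/ ~ clique A.
  move=> A; case: (boolP [forall x in A, forall y in A, (x != y) ==> x -- y]) => [cA|ncA].
    by left=> x y xA yA; move/forall_inP/(_ x xA)/forall_inP/(_ y yA)/implyP: cA.
  right=> cA; case/negP: ncA; apply/forall_inP => x xA; apply/forall_inP => y yA.
  exact/implyP/cA.
case: (cliqueP S) => [cS|ncS].
  apply: (split_clique S (~: S)) => //; first by move=> v; rewrite inE orbN.
  by move=> x y xS; rewrite inE; apply: join.
case: (cliqueP (~: S)) => [cS|ncSC].
  apply: (split_clique (~: S) S) => //; first by move=> v; rewrite inE orNb.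
  by move=> x y; rewrite inE sedge_sym => yS xS; apply: join.
have [q1 cq1] : exists q : pred G, {in S &, forall x y, q x = q y -> x != y -> x -- y}.
  apply/unip_two_cliques/(triad (~: S)) => // x y.
  by rewrite inE sedge_sym => yS xS; apply: join.
have [q2 cq2] : exists q : pred G, {in ~: S &, forall x y, q x = q y -> x != y -> x -- y}.
  by apply/unip_two_cliques/(triad S) => // x y xS; rewrite inE; apply: join.
have cq x y : (if x \in S then q1 x else q2 x) = (if y \in S then q1 y else q2 y) ->
    x != y -> x -- y.
  case: ifP => [xS|/negbT xS]; case: ifP => [yS|/negbT yS] qxy nxy.
  - exact: cq1.
  - exact: join.
  - by rewrite sedge_sym join.
  - by apply: cq2; rewrite ?inE.
exists (fun x => if x \in S then q1 x else q2 x); split.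
  by move=> x y _ _ qx qy; apply: cq; rewrite qx qy.
by move=> x y z _ _ _ /negbTE qx _ /negbTE qz _ _; apply: cq; rewrite qx qz.
Qed.

Lemma p3freeP (S : {set G}) : p3free S \/
  exists x y z, [/\ x \in S, y \in S & z \in S] /\
    [/\ x -- y, y -- z, x != z & ~~ (x -- z)].
Proof.
case: (boolP [forall x in S, forall y in S, forall z in S,
    [==> x -- y, y -- z, x != z => x -- z]]) => [p3|].
  left=> x y z xS yS zS; move/forall_inP/(_ x xS)/forall_inP/(_ y yS): p3.
  by move/forall_inP/(_ z zS)/implyP=> p3 xy yz nxz; move: (p3 xy); rewrite yz nxz.
rewrite negb_forall_in => /exists_inP[x xS].
rewrite negb_forall_in => /exists_inP[y yS].
rewrite negb_forall_in => /exists_inP[z zS].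
rewrite !negb_imply => /and4P[xy yz nxz xz].
by right; exists x, y, z.
Qed.

(** A side without an induced P_3 goes to the cluster part of the other, unipolar side; an induced
    P_3 on both sides would give 2P_3. *)
Lemma cut_unip (S : {set G}) x0 y0 : x0 \in S -> y0 \notin S ->
  (forall x y, x \in S -> y \notin S -> ~~ (x -- y)) -> unip [set: G].
Proof.
move=> x0S y0S cut.
have main (A B : {set G}) : (forall v, (v \in A) || (v \in B)) ->
    {in A & B, forall x y, ~~ (x -- y)} -> p3free A -> unip B -> unip [set: G].
  move=> AB eAB pA uB; apply: (@spider_unip _ set0 A B) => //.
  - by move=> v; rewrite inE; apply: AB.
  - by move=> x y; rewrite inE.
  - by move=> x y; rewrite inE.
have cutC : {in ~: S & S, forall x y, ~~ (x -- y)}.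
  by move=> x y; rewrite inE sedge_sym => yS xS; apply: cut.
case: (p3freeP S) => [pS|[a [b [c [[aS bS cS] [ab bc nac ac]]]]]].
  apply: (main S (~: S)) => // [v|x y xS|]; first by rewrite inE orbN.
    by rewrite inE; apply: cut.
  by apply: (@proper_unip _ x0); rewrite inE x0S.
case: (p3freeP (~: S)) => [pS|[a' [b' [c' [[aS' bS' cS'] [ab' bc' nac' ac']]]]]].
  by apply: (main (~: S) S) => // [v|]; [rewrite inE orNb|apply: proper_unip y0S].
case: (@P3P3_free a b c a' b' c') => // x y.
rewrite !inE in aS' bS' cS' * => hx hy; apply: cut.
  by case/or3P: hx => /eqP->.
by case/or3P: hy => /eqP->.
Qed.

Lemma module_unip (X : {set G}) a b c : a \in X -> b \in X -> c \in X ->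
  a -- b -> b -- c -> a != c -> ~~ (a -- c) ->
  (forall v, v \notin X ->
     {in X, forall x, v -- x} \/ {in X, forall x, ~~ (v -- x)}) ->
  (forall t t' n, t \notin X -> t' \notin X -> n \notin X ->
     t -- a -> t' -- a -> ~~ (n -- a) -> t != t' -> ~~ (t -- t') ->
     n -- t -> n -- t') ->
  (X = [set: G] -> unip [set: G]) -> unip [set: G].
Proof.
move=> aX bX cX ab bc nac ac mod XC uX.
pose T := [set v | v \notin X & v -- a].
pose N := [set v | v \notin X & ~~ (v -- a)].
have TX : {in T & X, forall t x, t -- x}.
  move=> t x; rewrite inE => /andP[tX ta] xX.
  by case: (mod t tX) => [|h]; [apply|rewrite (negbTE (h a aX)) in ta].
have NX : {in N & X, forall t x, ~~ (t -- x)}.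
  move=> t x; rewrite inE => /andP[tX ta] xX.
  by case: (mod t tX) => [h|]; [rewrite (h a aX) in ta|apply].
pose D t := [exists t' in T, (t != t') && ~~ (t -- t')].
pose Y := X :|: [set t in T | D t].
(* Otherwise [n] sees both [t] and its nonneighbour [t'], and [t], [t'] against [a], [c], [n] is a
   K_{2,3}. *)
have DN t n : t \in T -> D t -> n \in N -> ~~ (n -- t).
  move=> tT /exists_inP[t' t'T /andP[ntt tt]] nN; apply/negP => nt.
  have nt' : n -- t'.
    by move: tT t'T nN; rewrite !inE => /andP[? ?] /andP[? ?] /andP[? ?]; apply: (XC t).
  apply: (@K23_free t t' a c n) => //=; try exact: TX.
  - rewrite !inE negb_or nac andbT /=.
    by apply/andP; split; move: nN; rewrite inE; apply: contraTneq => <-;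
       rewrite ?aX ?cX.
  - by rewrite sedge_sym.
  - by rewrite sedge_sym.
  - by rewrite sedge_sym NX.
  - by rewrite sedge_sym NX.
(* If [Y] is everything, then all vertices outside [X] lie in [T], and [G] is a join unless [X] is
   everything. *)
have [YT|[v vY]] := setT_or_notin Y.
  have [|[v vX]] := setT_or_notin X; first exact: uX.
  apply: (@join_unip X a v) => // x y xX yX; rewrite sedge_sym TX //.
  by have := in_setT y; rewrite -YT !inE (negbTE yX) /= => /andP[].
apply: (@spider_unip _ [set t in T | ~~ D t] N Y).
- move=> w; rewrite !inE; case: (w \in X) => //=; case: (w -- a) => //=.
  by rewrite orNb.
- move=> t t'; rewrite inE => /andP[_ Dt]; rewrite inE => /andP[t'T _] ntt.
  by move: Dt; apply: contraR => tt; apply/exists_inP; exists t'; rewrite // ntt.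
(* A P_3 in [N] together with [a b c] would be a 2P_3. *)
- case: (p3freeP N) => [//|[a' [b' [c' [[aS' bS' cS'] [ab' bc' nac' ac']]]]]].
  case: (@P3P3_free a b c a' b' c') => // x y hx hy; rewrite sedge_sym NX //.
    by rewrite !inE in hy; case/or3P: hy => /eqP->.
  by rewrite !inE in hx; case/or3P: hx => /eqP->.
- move=> t x; rewrite inE => /andP[tT Dt]; rewrite inE => /orP[xX _|]; first exact: TX.
  rewrite inE => /andP[xT _] ntx.
  by move: Dt; apply: contraR => tt; apply/exists_inP; exists x; rewrite // ntx.
- move=> n x nN; rewrite inE => /orP[xX|]; first exact: NX.
  by rewrite inE => /andP[xT Dx]; apply: DN.
- exact: proper_unip vY.
Qed.

End Minimal.

(** * Induced paths on four vertices *)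

Definition p4 (T : Type) (e : rel T) (a b c d : T) : bool :=
  [&& e a b, e b c, e c d, ~~ e a c, ~~ e a d & ~~ e b d].

Definition p4_free (T : eqType) (e : rel T) : Prop :=
  forall a b c d, uniq [:: a; b; c; d] -> ~~ p4 e a b c d.

(** For [k = false] the graph on [S] is disconnected; for [k = true] its complement is. *)
Definition has_cut (T : finType) (e : rel T) (S : {set T}) (k : bool) : Prop :=
  exists A : {set T}, [/\ A \subset S, A != set0, A != S &
    {in A & S :\: A, forall x y, e x y = k}].

Lemma has_cut_setU1 (T : finType) (e : rel T) (S : {set T}) (v : T) :
  symmetric e -> p4_free e -> v \notin S -> has_cut e S false ->
  exists k, has_cut e (v |: S) k.
Proof.
move=> sym free vS [A [/subsetP AS A0 neqAS cut]].
have /set0Pn[a0 a0A] := A0.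
have [c0 c0C] : exists c0, c0 \in S :\: A.
  by apply/set0Pn; apply: contraNneq neqAS => /eqP; rewrite setD_eq0 eqEsubset => ->;
     rewrite andbT; apply/subsetP.
have eqS x : (x \in S) = (x \in A) || (x \in S :\: A).
  by rewrite inE; case: (boolP (x \in A)) => //= /AS.
move: {A0 neqAS} (S :\: A) c0C eqS cut => C c0C eqS cut.
have neqv x : x \in S -> x != v by move=> xS; apply: contraNneq vS => <-.
(* If [v] misses a vertex of [A'] and sees [y0] in [C'], the nonneighbours of [v] in [A'] are cut
   off: an edge from such an [x] to a neighbour [y] of [v] in [A'] would give the P_4 [x y v y0]. *)
have half (A' C' : {set T}) x0 y0 : (forall x, (x \in S) = (x \in A') || (x \in C')) ->
    x0 \in A' -> ~~ e v x0 -> y0 \in C' -> e v y0 ->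
    {in A' & C', forall x y, e x y = false} -> exists k, has_cut e (v |: S) k.
  move=> eqS' x0A vx0 y0C vy0 cut'; exists false, [set x in A' | ~~ e v x]; split.
  - by apply/subsetP => x; rewrite !inE => /andP[xA _]; rewrite eqS' xA orbT.
  - by apply/set0Pn; exists x0; rewrite inE x0A.
  - apply/eqP => /setP/(_ v); rewrite !inE eqxx => /andP[vA _].
    by rewrite eqS' vA in vS.
  move=> x y; rewrite !inE => /andP[xA vx] /andP[yB /orP[/eqP->|]].
    by rewrite sym; apply: negbTE.
  rewrite eqS' => /orP[yA|yC]; last exact: cut'.
  rewrite yA /= negbK in yB; apply/negbTE/negP => exy.
  have [xS yS y0S] : [/\ x \in S, y \in S & y0 \in S] by rewrite !eqS' xA yA y0C orbT.
  have xy0 : x != y0 by apply: contraNneq vx => ->.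
  have xy : x != y by apply: contraNneq vx => ->.
  have yy0 : y != y0 by apply: contraTneq exy => ->; rewrite cut'.
  suff: p4 e x y v y0.
    apply/negP/free.
    by rewrite /= !inE !negb_or xy xy0 yy0 !neqv // eq_sym neqv.
  by rewrite /p4 exy sym yB vy0 sym vx !cut'.
(* Either [v] sees nothing of [C], or [half] applies in one of the two directions, or [v] sees all
   of [S] and [k] is [true]. *)
case: (pickP [pred y in C | e v y]) => [y1 /andP[y1C vy1]|nC]; last first.
  exists false, C; split.
  - by apply/subsetP => x xC; rewrite inE eqS xC !orbT.
  - by apply/set0Pn; exists c0.
  - apply/eqP => /setP/(_ v); rewrite !inE eqxx => vC.
    by rewrite eqS vC orbT in vS.
  move=> x y xC; rewrite !inE => /andP[yC /orP[/eqP->|]].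
    by have := nC x; rewrite /= xC sym.
  by rewrite eqS (negbTE yC) orbF => yA; rewrite sym cut.
case: (pickP [pred x in A | ~~ e v x]) => [x1 /andP[x1A vx1]|nA].
  exact: (half A C x1 y1).
have vA x : x \in A -> e v x by move=> xA; have := nA x; rewrite /= xA => /negbFE.
case: (pickP [pred y in C | ~~ e v y]) => [x1 /andP[x1C vx1]|nC].
  apply: (half C A x1 a0) => //; [by move=> x; rewrite orbC|exact: vA|].
  by move=> x y xC yA; rewrite sym cut.
exists true, [set v]; split.
- by rewrite sub1set setU11.
- by apply/set0Pn; exists v; rewrite inE.
- apply/eqP => /setP/(_ a0); rewrite !inE (negbTE (neqv a0 _)) ?eqS ?a0A //.
move=> x y; rewrite !inE => /eqP-> /andP[/negbTE->] /=.
rewrite eqS => /orP[|yC]; first exact: vA.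
by have := nC y; rewrite /= yC => /negbFE.
Qed.

(* Seinsche's theorem: a P_4-free graph or its complement is disconnected. *)
Lemma p4_free_cut (T : finType) (e : rel T) (S : {set T}) :
  symmetric e -> p4_free e -> 1 < #|S| -> exists k, has_cut e S k.
Proof.
move=> sym free; have [n] := ubnP #|S|; elim: n S => // n IHn S ltSn S_gt1.
have /card_gt0P[v vS] : 0 < #|S| by apply: ltnW.
have cardS : #|S| = #|S :\ v|.+1 by rewrite (cardsD1 v) vS.
have [S'_gt1|S'_le1] := ltnP 1 #|S :\ v|; last first.
  have /cards1P[w Sw] : #|S :\ v| == 1 by rewrite eqn_leq S'_le1 -ltnS -cardS.
  exists (e v w), [set v]; split.
  - by rewrite sub1set.
  - by apply/set0Pn; exists v; rewrite inE.
  - by apply: contraTneq S_gt1 => <-; rewrite cards1.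
  by move=> x y /set1P-> ; rewrite Sw => /set1P->.
have vS' : v \notin S :\ v by rewrite !inE eqxx.
rewrite -(setD1K vS).
have [|[] cutk] := IHn (S :\ v) _ S'_gt1; first by rewrite -ltnS -cardS.
  (* A cut with [k = true] becomes one with [k = false] for the complement [e'], where the extension
     by [v] applies. *)
  pose e' x y := (x != y) && ~~ e x y.
  have e'E (S' A : {set T}) x y : x \in A -> y \in S' :\: A -> e' x y = ~~ e x y.
    move=> xA yS; rewrite /e'.
    by have -> : x != y by apply: contraTneq yS => <-; rewrite inE xA.
  have [k [A [AS A0 neqA cut]]] : exists k, has_cut e' (v |: S :\ v) k.
    apply: has_cut_setU1 => //.
    - by move=> x y; rewrite /e' eq_sym sym.
    - move=> a b c d; rewrite /= !inE !negb_or andbT.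
      case/and3P=> /and3P[ab ac ad] /andP[bc bd] cd.
      (* P_4 is self-complementary: the complement of the path [a b c d] is the path [b d a c]. *)
      have := free b d a c.
      rewrite /= !inE !negb_or ![_ == a]eq_sym ab ac ad bc bd ![d == _]eq_sym cd.
      move/(_ isT); apply: contra; rewrite /p4 /e' ab ac ad bc bd cd /=.
      by rewrite !negbK (sym b a) (sym d a) (sym d c) => /and5P[-> -> -> -> /andP[-> ->]].
    case: cutk => A [AS A0 neqA cut]; exists A; split=> // x y xA yS.
      by rewrite (e'E _ _ _ _ xA yS) cut.
  exists (~~ k), A; split=> // x y xA yS.
  by rewrite -(cut x y xA yS) (e'E _ _ _ _ xA yS) negbK.
exact: has_cut_setU1.
Qed.

(** * How a vertex attaches to a P_4 *)

Ltac edge_cases :=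
  repeat match goal with |- context [sedge ?x ?y] => case: (sedge x y) => //= end.

(* In the absence of a second P_4 in {a, b, c, d, v}, the vertex v sees none,
   all, or exactly the midpoints of the path a b c d. *)
Definition p4_type (G : sgraph) (a b c d v : G) : bool :=
  [&& (v -- a) == (v -- d), (v -- b) == (v -- c) & v -- a ==> v -- b].

Section P4.

Variable G : sgraph.
Implicit Types a b c d v : G.
Local Notation path4 := (p4 (@sedge G)).

Lemma p4_uniq a b c d : path4 a b c d -> uniq [:: a; b; c; d].
Proof.
case/and5P=> ab bc cd ac /andP[ad bd].
rewrite /= !inE !negb_or (edge_neq ab) (edge_neq bc) (edge_neq cd) !andbT /=.
apply/andP; split; [apply/andP; split|].
- by apply: contraNneq ad => ->.
- by apply: contraNneq ac => ->; rewrite sedge_sym.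
- by apply: contraNneq ad => <-.
Qed.

Lemma p4_induces a b c d : path4 a b c d -> induces_P4 [set x in [:: a; b; c; d]].
Proof.
move=> abcd; have uniq_abcd := p4_uniq abcd.
pose f (i : 'I_4) := nth a [:: a; b; c; d] i.
have embf : embedding (f : path_graph 4 -> G).
  split; first by move=> i j /eqP; rewrite nth_uniq // => /eqP/val_inj.
  case/and5P: abcd => ab bc cd /negbTE ac /andP[/negbTE ad /negbTE bd].
  by case=> [] [|[|[|[|//]]]] ? [[|[|[|[|//]]]] ?]; rewrite /f /= ?sedge_irr // sedge_sym.
have -> : [set x in [:: a; b; c; d]] = f @: [set: path_graph 4].
  apply/setP => x; rewrite inE; apply/idP/imsetP => [xs|[i _ ->]]; last exact: mem_nth.
  by exists (Ordinal (etrans (index_mem x _) xs : index x [:: a; b; c; d] < 4));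
    rewrite ?inE ?[RHS]nth_index.
exact: induced_image_iso embf.
Qed.

(** A version of [extends_P4] for vertex lists, without the condition that [v] lies outside. *)
Definition touches (s : seq G) v := exists p q r t,
  [/\ path4 p q r t, v \in [:: p; q; r; t] & has (mem s) [:: p; q; r; t]].

(** The new path meets the old one, which serves extendibility, and stays within the five vertices,
    which serves sparseness. *)
Lemma p4_partner a b c d v : path4 a b c d -> ~~ p4_type a b c d v ->
  exists p q r t, [/\ path4 p q r t, v \in [:: p; q; r; t],
    has (mem [:: a; b; c; d]) [:: p; q; r; t] &
    {subset [:: p; q; r; t] <= [:: v; a; b; c; d]}].
Proof.
move=> abcd bad.
(* A run through all neighbourhoods of [v] on the path: each bad one yields one of these eight
   paths. *)
have : [|| path4 v a b c, path4 v b c d, path4 a v c d, path4 a b v d, path4 a b c v,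
           path4 b c d v, path4 a v d c | path4 b a v d].
  move: abcd bad; rewrite /p4_type /p4.
  rewrite ?(sedge_sym v) ?(sedge_sym d) ?(sedge_sym c) ?(sedge_sym b) ?(sedge_sym a).
  by edge_cases.
have wit p q r t : v \in [:: p; q; r; t] ->
    has (mem [:: a; b; c; d]) [:: p; q; r; t] ->
    all (mem [:: v; a; b; c; d]) [:: p; q; r; t] -> path4 p q r t ->
    exists p q r t, [/\ path4 p q r t, v \in [:: p; q; r; t],
      has (mem [:: a; b; c; d]) [:: p; q; r; t] &
      {subset [:: p; q; r; t] <= [:: v; a; b; c; d]}].
  by move=> vU hU /allP sU U; exists p, q, r, t.
by case/or4P=> [|||/or4P[|||/orP[|]]]; apply: wit; rewrite /= !inE ?eqxx ?orbT.
Qed.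

Lemma p4_type_untouched a b c d v : path4 a b c d ->
  ~ touches [:: a; b; c; d] v -> p4_type a b c d v.
Proof.
move=> abcd; apply: contra_notT => /(p4_partner abcd)[p [q [r [t [U vU hU _]]]]].
by exists p, q, r, t.
Qed.

(** Otherwise the five vertices carry a second P_4, which differs from the first because it contains
    [v]. *)
Lemma sparse_p4_type a b c d v : P4_sparse G -> path4 a b c d ->
  v \notin [:: a; b; c; d] -> p4_type a b c d v.
Proof.
move=> sparse abcd vW; apply/negPn/negP => /(p4_partner abcd).
move=> [p [q [r [t [U vU _ sU]]]]].
have cardS : #|[set x in [:: v; a; b; c; d]]| = 5.
  by rewrite cardsE; apply/card_uniqP; rewrite cons_uniq vW p4_uniq.
have sub (s : seq G) : {subset s <= [:: v; a; b; c; d]} ->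
    [set x in s] \subset [set x in [:: v; a; b; c; d]].
  by move=> ss; apply/subsetP => x; rewrite !in_set; apply: ss.
have sW : {subset [:: a; b; c; d] <= [:: v; a; b; c; d]} by move=> x xs; rewrite in_cons xs orbT.
have /setP/(_ v) := sparse _ cardS _ _ (sub _ sW) (sub _ sU)
  (p4_induces abcd) (p4_induces U).
by rewrite !in_set vU (negbTE vW).
Qed.

Lemma extendible_touches a b c d v w : P4_extendible G -> path4 a b c d ->
  v \notin [:: a; b; c; d] -> w \notin [:: a; b; c; d] ->
  touches [:: a; b; c; d] v -> touches [:: a; b; c; d] w -> v = w.
Proof.
move=> ext abcd vW wW tv tw.
have extends u : u \notin [:: a; b; c; d] -> touches [:: a; b; c; d] u ->
    extends_P4 [set x in [:: a; b; c; d]] u.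
  move=> uW [p [q [r [t [U uU /hasP[x xU xW]]]]]]; split; first by rewrite in_set.
  exists [set x in [:: p; q; r; t]]; split; [exact: p4_induces|by rewrite in_set|].
  by apply/set0Pn; exists x; rewrite in_setI !in_set xU.
exact: ext (p4_induces abcd) _ _ (extends v vW tv) (extends w wW tw).
Qed.

End P4.

(** * Unipolarity of P_4-sparse and P_4-extendible graphs *)

Lemma clique_set3 (G : sgraph) (u v w : G) :
  u -- v -> w -- u -> w -- v -> clique [set u; v; w].
Proof.
move=> uv wu wv x y; rewrite !inE -!orbA.
by case/or3P=> /eqP->; case/or3P=> /eqP->; rewrite ?eqxx // sedge_sym.
Qed.

Lemma p3free_set2 (G : sgraph) (u v : G) : p3free [set u; v].
Proof.
by move=> x y z; rewrite !inE => /orP[] /eqP-> /orP[] /eqP-> /orP[] /eqP->;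
  rewrite ?sedge_irr ?eqxx.
Qed.

Section Main.

Variable G : sgraph.
Hypothesis proper_unip : forall (S : {set G}) v, v \notin S -> unip S.
Hypothesis K23_free : biclique23_free G.
Hypothesis P3P3_free : two_path3_free G.
Local Notation path4 := (p4 (@sedge G)).

Lemma p4_free_unip : p4_free (@sedge G) -> unip [set: G].
Proof.
move=> free; have [|le1] := ltnP 1 #|[set: G]|.
  move=> /(p4_free_cut (@sedge_sym G) free)[k [A [_ /set0Pn[x xA] neqA cut]]].
  have [eqA|[y yA]] := setT_or_notin A; first by rewrite eqA eqxx in neqA.
  have {}cut u v : u \in A -> v \notin A -> u -- v = k.
    by move=> uA vA; apply: cut; rewrite ?inE ?vA.
  case: k cut => cut.
    by apply: (join_unip proper_unip K23_free xA yA) => u v uA vA; rewrite cut.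
  by apply: (cut_unip proper_unip P3P3_free xA yA) => u v uA vA; rewrite cut.
exists (fun=> true); split=> // x y _ _ _ _ nxy.
have /card_le1P/(_ x) := le1.
by move/(_ (in_setT x) y); rewrite !inE eq_sym (negbTE nxy).
Qed.

(** The last three hypotheses capture what the two graph classes say about P_4s with at least two
    vertices off the path: in the sparse case other vertices are typed for these too, in the
    extendible case no such P_4 exists. *)
Lemma typed_unip a b c d : path4 a b c d ->
  (forall v, v \notin [:: a; b; c; d] -> p4_type a b c d v) ->
  (forall t m v, path4 a t c m -> t \notin [:: a; b; c; d] ->
     m \notin [:: a; b; c; d] -> v \notin [:: a; t; c; m] -> p4_type a t c m v) ->
  (forall n m v, path4 n m b a -> n \notin [:: a; b; c; d] ->
     m \notin [:: a; b; c; d] -> v \notin [:: n; m; b; a] -> p4_type n m b a v) ->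
  (forall n t t', path4 n t a t' -> n \notin [:: a; b; c; d] ->
     t \notin [:: a; b; c; d] -> t' \notin [:: a; b; c; d] ->
     t' -- b -> ~~ (n -- b) -> False) ->
  unip [set: G].
Proof.
move=> abcd typW typT typN crossW.
have /and5P[ab bc cd ac /andP[ad bd]] := abcd.
pose W := [set x in [:: a; b; c; d]].
pose T := [set v | (v \notin W) && v -- a].
pose M := [set v | [&& v \notin W, ~~ (v -- a) & v -- b]].
pose N := [set v | (v \notin W) && ~~ (v -- b)].
have TP t : t \in T -> [/\ t \notin [:: a; b; c; d], t -- a, t -- b, t -- c & t -- d].
  rewrite !in_set => /andP[tW ta]; have /and3P[/eqP ad' /eqP bc' h] := typW t tW.
  by rewrite -ad' -bc' ta (implyP h).
have MP m : m \in M -> [/\ m \notin [:: a; b; c; d], ~~ (m -- a), m -- b, m -- c & ~~ (m -- d)].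
  rewrite !in_set => /and3P[mW ma mb]; have /and3P[/eqP ad' /eqP bc' h] := typW m mW.
  by rewrite -ad' -bc'.
have NP n : n \in N ->
    [/\ n \notin [:: a; b; c; d], ~~ (n -- a), ~~ (n -- b), ~~ (n -- c) & ~~ (n -- d)].
  rewrite !in_set => /andP[nW nb]; have /and3P[/eqP ad' /eqP bc' h] := typW n nW.
  by rewrite -ad' -bc' nb (contra (implyP h)).
have TM x y : x \in T -> y \in M -> x != y.
  by move=> /TP[_ xa _ _ _] /MP[_ ya _ _ _]; apply: contraNneq ya => <-.
have TN x y : x \in T -> y \in N -> x != y.
  by move=> /TP[_ xa _ _ _] /NP[_ ya _ _ _]; apply: contraNneq ya => <-.
have MN x y : x \in M -> y \in N -> x != y.
  by move=> /MP[_ _ xb _ _] /NP[_ _ yb _ _]; apply: contraNneq yb => <-.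
(* In a P_4-sparse graph a nonadjacent pair (t, m) makes W part of a thick
   spider, and an adjacent pair (n, m) makes it part of a thin one. *)
pose bad t m := [&& t \in T, m \in M & ~~ (t -- m)].
pose leg n m := [&& n \in N, m \in M & n -- m].
(* Now [a t c m] is also a P_4, and the other vertices are typed with respect to it; [legP] does the
   same for [n m b a]. *)
have badP t m : bad t m -> forall v, v \notin [:: a; b; c; d] -> v != t -> v != m ->
    [/\ (v -- a) = (v -- m), (v -- t) = (v -- c) & v -- a ==> v -- t].
  case/and3P=> tT mM tm v vW vt vm.
  have [[tW ta tb tc td] [mW ma mb mc md]] := (TP t tT, MP m mM).
  have /and3P[/eqP h1 /eqP h2 h3] : p4_type a t c m v.
    apply: typT => //; last by move: vW; rewrite !inE !negb_or vt vm; case/and4P=> -> _ ->.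
    by rewrite /p4 sedge_sym ta tc sedge_sym mc ac sedge_sym ma tm.
  by [].
have legP n m : leg n m -> forall v, v \notin [:: a; b; c; d] -> v != n -> v != m ->
    [/\ (v -- n) = (v -- a), (v -- m) = (v -- b) & v -- n ==> v -- m].
  case/and3P=> nN mM nm v vW vn vm.
  have [[nW na nb nc nd] [mW ma mb mc md]] := (NP n nN, MP m mM).
  have /and3P[/eqP h1 /eqP h2 h3] : p4_type n m b a v.
    apply: typN => //; last by move: vW; rewrite !inE !negb_or vn vm; case/and4P=> -> ->.
    by rewrite /p4 nm mb sedge_sym ab nb na ma.
  by [].
pose T' := [set t in T | [exists m, bad t m]].
pose M1 := [set m in M | [exists t, bad t m]].
pose N' := [set n in N | [exists m, leg n m]].
pose M2 := [set m in M | [exists n, leg n m]].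
have badT t t1 m : bad t m -> t1 \in T -> t1 != t -> t1 -- t.
  move=> btm t1T nt; have /and3P[tT mM _] := btm; have [t1W t1a _ _ _] := TP t1 t1T.
  by have [_ _] := badP t m btm t1 t1W nt (TM _ _ t1T mM); rewrite t1a.
have badM t m m1 : bad t m -> m1 \in M -> m1 != m -> m1 -- t /\ ~~ (m1 -- m).
  move=> btm m1M nm; have /and3P[tT mM _] := btm; have [m1W m1a _ m1c _] := MP m1 m1M.
  have nmt : m1 != t by rewrite eq_sym TM.
  by have [<- -> _] := badP t m btm m1 m1W nmt nm.
have badN t m n : bad t m -> n \in N -> ~~ (n -- t) /\ ~~ (n -- m).
  move=> btm nN; have /and3P[tT mM _] := btm; have [nW na _ nc _] := NP n nN.
  have nt : n != t by rewrite eq_sym TN.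
  have nm : n != m by rewrite eq_sym MN.
  by have [<- -> _] := badP t m btm n nW nt nm.
have legT n m t : leg n m -> t \in T -> t -- n /\ t -- m.
  move=> lnm tT; have /and3P[nN mM _] := lnm; have [tW ta tb _ _] := TP t tT.
  by have [-> -> _] := legP n m lnm t tW (TN _ _ tT nN) (TM _ _ tT mM).
have legM n m m1 : leg n m -> m1 \in M -> m1 != m -> ~~ (m1 -- n) /\ m1 -- m.
  move=> lnm m1M nm; have /and3P[nN mM _] := lnm; have [m1W m1a m1b _ _] := MP m1 m1M.
  by have [-> -> _] := legP n m lnm m1 m1W (MN _ _ m1M nN) nm.
have legN n m n1 : leg n m -> n1 \in N -> n1 != n -> ~~ (n1 -- n).
  move=> lnm n1N nn; have /and3P[nN mM _] := lnm; have [n1W n1a _ _ _] := NP n1 n1N.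
  have nm : n1 != m by rewrite eq_sym MN.
  by have [-> _ _] := legP n m lnm n1 n1W nn nm.
have T'P t : t \in T' -> exists2 m, t \in T & bad t m.
  by rewrite inE => /andP[tT /existsP[m btm]]; exists m.
have M1P m : m \in M1 -> exists2 t, m \in M & bad t m.
  by rewrite inE => /andP[mM /existsP[t btm]]; exists t.
have N'P n : n \in N' -> exists2 m, n \in N & leg n m.
  by rewrite inE => /andP[nN /existsP[m lnm]]; exists m.
have M2P m : m \in M2 -> exists2 n, m \in M & leg n m.
  by rewrite inE => /andP[mM /existsP[n lnm]]; exists n.
(* A vertex of [T] outside [T'] sees all of [M], and a vertex of [N] outside [N'] sees none of it,
   so [X] is a module. *)
pose X := W :|: M :|: T' :|: N'.
have outX v : v \notin X -> (v \in T) && (v \notin T') || (v \in N) && (v \notin N').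
  rewrite /X !in_setU !negb_or => /andP[/andP[/andP[vW vM] ->] ->]; rewrite !andbT.
  rewrite !(in_set (fun v => (v \notin W) && _)) vW /=.
  by move: vM; rewrite in_set vW; case: (v -- a).
have WP v (Q : G -> Prop) : v \in W -> Q a -> Q b -> Q c -> Q d -> Q v.
  by rewrite !inE => /or4P[] /eqP->.
apply: (@module_unip _ proper_unip K23_free P3P3_free X a b c) => //.
- by rewrite !inE eqxx.
- by rewrite !inE eqxx ?orbT.
- by rewrite !inE eqxx ?orbT.
- by have := p4_uniq abcd; rewrite /= !inE !negb_or => /and3P[/and3P[]].
- move=> v /outX /orP[/andP[vT vT']|/andP[vN vN']]; [left|right].
    have [vW va vb vc vd] := TP v vT.
    move=> x; rewrite !in_setU => /orP[/orP[/orP[xW|xM]|xT']|xN'].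
    + by apply: (WP x (fun x => v -- x)).
    + move: vT'; rewrite inE vT /=; apply: contraR => vx.
      by apply/existsP; exists x; rewrite /bad vT xM.
    + have [m xT bxm] := T'P x xT'; apply: (badT x v m bxm vT).
      by apply: contraNneq vT' => ->.
    + by have [m xN lxm] := N'P x xN'; have [] := legT x m v lxm vT.
  have [vW va vb vc vd] := NP v vN.
  move=> x; rewrite !in_setU => /orP[/orP[/orP[xW|xM]|xT']|xN'].
  + by apply: (WP x (fun x => ~~ (v -- x))).
  + move: vN'; rewrite inE vN /=; apply: contra => vx.
    by apply/existsP; exists x; rewrite /leg vN xM.
  + by have [m xT bxm] := T'P x xT'; have [] := badN x m v bxm vN.
  + have [m xN lxm] := N'P x xN'; apply: (legN x m v lxm vN).
    by apply: contraNneq vN' => ->.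
- move=> t t' n /outX tX /outX t'X /outX nX ta t'a na ntt tt nt.
  have inT u : (u \in T) && (u \notin T') || (u \in N) && (u \notin N') ->
      u -- a -> u \in T.
    by case/orP=> /andP[//] /NP[_ /negbTE->].
  have inN u : (u \in T) && (u \notin T') || (u \in N) && (u \notin N') ->
      ~~ (u -- a) -> u \in N.
    by case/orP=> /andP[//] /TP[_ ->].
  have [tW _ _ _ _] := TP t (inT t tX ta).
  have [t'W _ t'b _ _] := TP t' (inT t' t'X t'a).
  have [nW _ nb _ _] := NP n (inN n nX na).
  apply: contraT => nt'; exfalso; apply: (crossW n t t') => //.
  by rewrite /p4 nt ta sedge_sym t'a na nt' tt.
move=> XT.
have cover v : [|| v \in W, v \in M, v \in T' | v \in N'].
  by have := in_setT v; rewrite -XT !in_setU -!orbA.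
(* The members of [M2] are pairwise adjacent and extend the body; those of [M1] are pairwise
   nonadjacent and extend the legs. The head [M0] keeps the vertices of [M] in neither. *)
pose K := [set b; c] :|: T' :|: M2.
pose S := [set a; d] :|: M1 :|: N'.
pose M0 := M :\: (M1 :|: M2).
apply: (@spider_unip _ K S M0).
- move=> v; rewrite !in_setU !in_set1 in_setD in_setU.
  case/or4P: (cover v) => [vW|->|->|->]; rewrite ?orbT //.
    by move: vW; rewrite in_set !inE => /or4P[] ->; rewrite ?orbT.
  by case: (v \in M1); case: (v \in M2); rewrite ?orbT.
- have bcT x : x \in T' -> x -- b /\ x -- c.
    by case/T'P=> m /TP[].
  have bcM x : x \in M2 -> x -- b /\ x -- c.
    by case/M2P=> m /MP[].
  have MT x y : x \in M2 -> y \in T' -> y -- x.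
    by move=> /M2P[n _ lnx] /T'P[m yT _]; have [] := legT n x y lnx yT.
  move=> x y; rewrite !in_setU !in_set1 -!orbA.
  case/or4P=> [/eqP->|/eqP->|xT|xM]; case/or4P=> [/eqP->|/eqP->|yT|yM] nxy;
    rewrite ?eqxx // in nxy *;
    try (by have [] := bcT _ xT); try (by have [] := bcM _ xM);
    try (by rewrite sedge_sym; have [] := bcT _ yT);
    try (by rewrite sedge_sym; have [] := bcM _ yM).
  + by rewrite sedge_sym.
  + have [m yT1 bym] := T'P y yT; have [m1 xT1 _] := T'P x xT.
    exact: (badT y x m bym xT1).
  + exact: MT.
  + by rewrite sedge_sym MT.
  + have [n yM1 lny] := M2P y yM; have [n1 xM1 _] := M2P x xM.
    by have [] := legM n y x lny xM1 nxy.
- have adM x : x \in M1 -> ~~ (x -- a) /\ ~~ (x -- d).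
    by case/M1P=> m /MP[].
  have adN x : x \in N' -> ~~ (x -- a) /\ ~~ (x -- d).
    by case/N'P=> m /NP[].
  have MN' x y : x \in M1 -> y \in N' -> ~~ (y -- x).
    by move=> /M1P[t _ btx] /N'P[m yN _]; have [] := badN t x y btx yN.
  suff indS : {in S &, forall x y, ~~ (x -- y)}.
    by move=> x y z xS yS _ xy; rewrite (negbTE (indS x y xS yS)) in xy.
  move=> x y; rewrite !in_setU !in_set1 -!orbA.
  have [->|nxy] := eqVneq x y; first by rewrite sedge_irr.
  case/or4P=> [/eqP ex|/eqP ex|xM|xN]; case/or4P=> [/eqP ey|/eqP ey|yM|yN];
    rewrite ?ex ?ey ?sedge_irr //;
    try (by have [] := adM _ xM); try (by have [] := adN _ xN);
    try (by rewrite sedge_sym; have [] := adM _ yM);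
    try (by rewrite sedge_sym; have [] := adN _ yN).
  + by rewrite sedge_sym.
  + have [t yM1 bty] := M1P y yM; have [t1 xM1 _] := M1P x xM.
    by have [] := badM t y x bty xM1 nxy.
  + by rewrite sedge_sym MN'.
  + exact: MN'.
  + have [m yN1 lym] := N'P y yN; have [m1 xN1 _] := N'P x xN.
    exact: (legN y m x lym xN1).
- move=> x y; rewrite !in_setU !in_set1 in_setD in_setU negb_or -!orbA => xK.
  case/andP=> /andP[yM1 yM2] yM nxy; have [yW ya yb yc yd] := MP y yM.
  case/or4P: xK => [/eqP->|/eqP->|xT|xM]; first by rewrite sedge_sym.
  + by rewrite sedge_sym.
  + have [m xT1 _] := T'P x xT; move: yM1; rewrite inE yM /=; apply: contraR => xy.
    by apply/existsP; exists x; rewrite /bad xT1 yM.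
  + have [n xM1 lnx] := M2P x xM; rewrite sedge_sym.
    by rewrite eq_sym in nxy; have [] := legM n x y lnx yM nxy.
- move=> x y; rewrite !in_setU !in_set1 in_setD in_setU negb_or -!orbA => xS.
  case/andP=> /andP[yM1 yM2] yM; have [yW ya yb yc yd] := MP y yM.
  case/or4P: xS => [/eqP->|/eqP->|xM|xN]; first by rewrite sedge_sym.
  + by rewrite sedge_sym.
  + have [t xM1 btx] := M1P x xM; rewrite sedge_sym.
    have nyx : y != x by apply: contraNneq yM1 => ->.
    by have [] := badM t x y btx yM nyx.
  + have [m xN1 _] := N'P x xN; move: yM2; rewrite inE yM /=; apply: contra => xy.
    by apply/existsP; exists x; rewrite /leg xN1 yM.
- by apply: (@proper_unip _ a); rewrite !inE eqxx andbF.
Qed.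

Lemma p4_free_or_p4 : p4_free (@sedge G) \/ exists a b c d, path4 a b c d.
Proof.
case: (pickP (fun u : G * G * (G * G) => path4 u.1.1 u.1.2 u.2.1 u.2.2)).
  by move=> u abcd; right; exists u.1.1, u.1.2, u.2.1, u.2.2.
by move=> none; left=> a b c d _; have /= -> := none (a, b, (c, d)).
Qed.

Lemma sparse_unip : P4_sparse G -> unip [set: G].
Proof.
move=> sparse; have typ a b c d v := @sparse_p4_type G a b c d v sparse.
case: p4_free_or_p4 => [|[a [b [c [d abcd]]]]]; first exact: p4_free_unip.
apply: (typed_unip abcd) => [v|t m v atcm _ _|n m v nmba _ _|]; try exact: typ.
move=> n t t' ntat' nW tW t'W t'b nb.
have nWb v : v \notin [:: a; b; c; d] -> b != v.
  by apply: contraNneq => <-; rewrite !inE eqxx orbT.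
have bU : b \notin [:: n; t; a; t'].
  rewrite !inE !negb_or (nWb n nW) (nWb t tW) (nWb t' t'W) eq_sym edge_neq //.
  by case/and5P: abcd.
(* A typed [b] sees both ends [n] and [t'] of the path or neither. *)
have /and3P[/eqP] := typ _ _ _ _ b ntat' bU.
by rewrite (sedge_sym b n) (sedge_sym b t') (negbTE nb) t'b.
Qed.

(** Each P_4 in the last hypotheses of [typed_unip] has two distinct vertices off the path that
    touch it, which extendibility would identify. *)
Lemma extendible_typed_unip a b c d : P4_extendible G -> path4 a b c d ->
  (forall v, v \notin [:: a; b; c; d] -> p4_type a b c d v) -> unip [set: G].
Proof.
move=> ext abcd typ; apply: (typed_unip abcd) => //.
- move=> t m v atcm tW mW _; exfalso.
  have : t = m.
    apply: (extendible_touches ext abcd) => //; exists a, t, c, m;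
      by split; rewrite //= ?inE ?eqxx ?orbT.
  by move=> tm; have := p4_uniq atcm; rewrite tm /= !inE eqxx !orbT !andbF.
- move=> n m v nmba nW mW _; exfalso.
  have : n = m.
    apply: (extendible_touches ext abcd) => //; exists n, m, b, a;
      by split; rewrite //= ?inE ?eqxx ?orbT.
  by move=> nm; have := p4_uniq nmba; rewrite nm /= !inE eqxx.
- move=> n t t' ntat' nW tW t'W _ _.
  have : t = t'.
    apply: (extendible_touches ext abcd) => //; exists n, t, a, t';
      by split; rewrite //= ?inE ?eqxx ?orbT.
  by move=> nm; have := p4_uniq ntat'; rewrite nm /= !inE eqxx !orbT !andbF.
Qed.

Hypothesis C5_free : cycle5_free G.

(** By extendibility [x] is the only vertex off the path that touches it, so no P_4 meeting the path
    leaves [Q]. Hence all vertices outside [Q] are typed, and [Q] together with those that see just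
    the midpoints is a module. *)
Lemma extendible_partner_unip a b c d x : P4_extendible G -> path4 a b c d ->
  x \notin [:: a; b; c; d] -> ~~ p4_type a b c d x -> unip [set: G].
Proof.
move=> ext abcd xW badx.
have touchx : touches [:: a; b; c; d] x.
  by have [p [q [r [t [U xU hU _]]]]] := p4_partner abcd badx; exists p, q, r, t.
have untouched v : v \notin [:: x; a; b; c; d] -> ~ touches [:: a; b; c; d] v.
  rewrite in_cons negb_or => /andP[/eqP nvx vW] tv; case: nvx.
  exact: (extendible_touches ext abcd).
pose Q := [set v in [:: x; a; b; c; d]].
have no_p4 v p q r t : v \notin Q -> v \in [:: p; q; r; t] ->
    has (mem [:: a; b; c; d]) [:: p; q; r; t] -> ~~ path4 p q r t.
  by rewrite in_set => vQ vU hU; apply/negP => U; case: (untouched v vQ); exists p, q, r, t.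
have typ v : v \notin Q -> p4_type a b c d v.
  by rewrite in_set => vQ; apply: p4_type_untouched => //; apply: untouched.
pose M := [set v | [&& v \notin Q, ~~ (v -- a) & v -- b]].
have TP t : t \notin Q -> t -- a -> [/\ t -- b, t -- c, t -- d & t -- x].
  move=> tQ ta; have /and3P[/eqP td /eqP tc tb] := typ t tQ.
  rewrite ta in td tb; rewrite /= in tb; rewrite tb in tc.
  split; rewrite -?tc -?td //; apply: contraT => tx.
  (* If [t] missed [x], every bad neighbourhood of [x] would give a P_4 [x p t q] with [p] and [q]
     on the path. *)
  have no p q : p \in [:: a; b; c; d] -> ~~ path4 x p t q.
    by move=> pW; apply: (no_p4 t); rewrite //= ?pW ?inE ?eqxx ?orbT.
  have := no a c; have := no a d; have := no b d; have := no c a.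
  have := no d a; have := no d b; rewrite !inE !eqxx !orbT => nodb noda noca nobd noad noac.
  move: (nodb isT) (noda isT) (noca isT) (nobd isT) (noad isT) (noac isT).
  move: badx abcd tx ta tb (esym tc) (esym td); rewrite /p4_type /p4.
  rewrite ?(sedge_sym t) ?(sedge_sym x) ?(sedge_sym d) ?(sedge_sym c) ?(sedge_sym b) ?(sedge_sym a).
  by edge_cases.
have MP m : m \in M -> [/\ m \notin Q, ~~ (m -- a), m -- b, m -- c & ~~ (m -- d)].
  rewrite [m \in M]in_set => /and3P[mQ ma mb].
  by have /and3P[/eqP <- /eqP <- _] := typ m mQ.
have NP n : n \notin Q -> ~~ (n -- b) ->
    [/\ ~~ (n -- a), ~~ (n -- c), ~~ (n -- d) & ~~ (n -- x)].
  move=> nQ nb; have /and3P[/eqP nd /eqP nc na] := typ n nQ.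
  rewrite (negbTE nb) in nc na; rewrite implybF in na; rewrite (negbTE na) in nd.
  split; rewrite -?nc -?nd //; apply/negP => nx.
  (* Likewise, an edge from [n] to [x] would extend to a P_4 [n x p q]. *)
  have no p q : p \in [:: a; b; c; d] -> ~~ path4 n x p q.
    by move=> pW; apply: (no_p4 n); rewrite //= ?pW ?inE ?eqxx ?orbT.
  have := no a b; have := no b a; have := no b c; have := no c b.
  have := no c d; have := no d c; rewrite !inE !eqxx !orbT => n1 n2 n3 n4 n5 n6.
  move: (n1 isT) (n2 isT) (n3 isT) (n4 isT) (n5 isT) (n6 isT).
  move: badx abcd nx nb na (esym nc) (esym nd); rewrite /p4_type /p4.
  rewrite ?(sedge_sym n) ?(sedge_sym x) ?(sedge_sym d) ?(sedge_sym c) ?(sedge_sym b) ?(sedge_sym a).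
  by edge_cases.
have /and5P[ab bc cd ac /andP[ad bd]] := abcd.
pose X := Q :|: M.
have QP v (P : G -> Prop) : v \in Q -> P x -> P a -> P b -> P c -> P d -> P v.
  by rewrite !inE => /or4P[/eqP->|/eqP->|/eqP->|/orP[]/eqP->].
have [_ xb_neq xc_neq _] : [/\ x != a, x != b, x != c & x != d].
  by move: xW; rewrite !inE !negb_or => /and4P[].
have notQ u v : u \notin Q -> v \in Q -> u != v.
  by move=> uQ vQ; apply: contraNneq uQ => ->.
have outX v : v \notin X -> v \notin Q /\ (~~ (v -- a) -> ~~ (v -- b)).
  rewrite in_setU negb_or => /andP[vQ vM]; split=> // va.
  by move: vM; rewrite [v \in M]in_set vQ va.
have [xQ aQ bQ cQ dQ] : [/\ x \in Q, a \in Q, b \in Q, c \in Q & d \in Q].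
  by rewrite !inE !eqxx !orbT.
apply: (@module_unip _ proper_unip K23_free P3P3_free X a b c) => //;
  try by rewrite in_setU ?aQ ?bQ ?cQ.
- by have := p4_uniq abcd; rewrite /= !inE !negb_or => /and3P[/and3P[]].
- move=> v /outX[vQ vN]; case: (boolP (v -- a)) => va; [left|right].
    have [vb vc vd vx] := TP v vQ va.
    move=> y; rewrite in_setU => /orP[yQ|yM]; first by apply: (QP y (fun y => v -- y)).
    have [yQ ya yb yc yd] := MP y yM; apply: contraT => vy.
    have /negP[] : ~~ path4 a v c y.
      by apply: (no_p4 v); rewrite //= ?inE ?eqxx ?orbT.
    by rewrite /p4 (sedge_sym a v) va vc (sedge_sym c y) yc ac (sedge_sym a y) ya vy.
  have vb := vN va; have [_ vc vd vx] := NP v vQ vb.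
  move=> y; rewrite in_setU => /orP[yQ|yM]; first by apply: (QP y (fun y => ~~ (v -- y))).
  have [yQ ya yb yc yd] := MP y yM; apply/negP => vy.
  have /negP[] : ~~ path4 v y b a.
    by apply: (no_p4 v); rewrite //= ?inE ?eqxx ?orbT.
  by rewrite /p4 vy yb (sedge_sym b a) ab vb va ya.
- move=> t t' n /outX[tQ _] /outX[t'Q _] /outX[nQ nN] ta t'a na ntt tt nt.
  apply: contraT => nt'.
  have /negP[] : ~~ path4 n t a t'.
    by apply: (no_p4 t); rewrite //= ?inE ?eqxx ?orbT.
  by rewrite /p4 nt ta (sedge_sym a t') t'a na nt' tt.
move=> XT.
have cover v : (v \in Q) || (v \in M) by have := in_setT v; rewrite -XT in_setU.
have unipM : unip M by apply: (@proper_unip _ a); rewrite in_set aQ.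
have unip0 : unip (set0 : {set G}) by apply: (@proper_unip _ a); rewrite inE.
(* Adding a vertex of M creates no new P_4, which leaves eight possible
   neighbourhoods for the partner x. *)
have typM m : m \in M ->
    if m -- x then
      [|| x -- b && x -- c, [&& x -- a, ~~ (x -- b), x -- c & ~~ (x -- d)]
        | [&& ~~ (x -- a), x -- b, ~~ (x -- c) & x -- d]]
    else [&& x -- b, ~~ (x -- c) & ~~ (x -- d)] || [&& ~~ (x -- a), ~~ (x -- b) & x -- c].
  move=> mM; have [mQ ma mb mc md] := MP m mM.
  have no p q r t : m \in [:: p; q; r; t] -> has (mem [:: a; b; c; d]) [:: p; q; r; t] ->
    ~~ path4 p q r t by apply: no_p4.
  have h1 : ~~ path4 a b m x by apply: no; rewrite /= !inE ?eqxx ?orbT.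
  have h2 : ~~ path4 a x c m by apply: no; rewrite /= !inE ?eqxx ?orbT.
  have h3 : ~~ path4 a x m c by apply: no; rewrite /= !inE ?eqxx ?orbT.
  have h4 : ~~ path4 b m x d by apply: no; rewrite /= !inE ?eqxx ?orbT.
  have h5 : ~~ path4 d c m x by apply: no; rewrite /= !inE ?eqxx ?orbT.
  have h6 : ~~ path4 d x b m by apply: no; rewrite /= !inE ?eqxx ?orbT.
  have h7 : ~~ path4 m b a x by apply: no; rewrite /= !inE ?eqxx ?orbT.
  have h8 : ~~ path4 m c d x by apply: no; rewrite /= !inE ?eqxx ?orbT.
  move: abcd badx ma mb mc md h1 h2 h3 h4 h5 h6 h7 h8; rewrite /p4_type /p4.
  rewrite ?(sedge_sym m) ?(sedge_sym x) ?(sedge_sym d) ?(sedge_sym c) ?(sedge_sym b) ?(sedge_sym a).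
  by edge_cases.
have coverQ v : [|| v == x, v == a, v == b, v == c, v == d | v \in M].
  by have := cover v; rewrite in_set !inE -!orbA.
have p3_adx : ~~ (x -- a && x -- d) -> p3free [set a; d; x].
  move=> xad u v w; rewrite !inE -!orbA.
  by case/or3P=> /eqP->; case/or3P=> /eqP->; case/or3P=> /eqP->;
    rewrite ?sedge_irr ?eqxx // ?(sedge_sym a) ?(sedge_sym d) ?(sedge_sym x);
    move: xad ad; rewrite ?(sedge_sym a) ?(sedge_sym d) ?(sedge_sym x);
    edge_cases.
have bcM u v : u \in [set b; c] -> v \in M -> u -- v.
  by move=> /set2P ubc /MP[_ _ vb vc _]; rewrite sedge_sym; case: ubc => ->.
have MS u m : u \in [set a; d] -> m \in M -> ~~ (u -- m).
  by move=> /set2P uad /MP[_ ma _ _ md]; rewrite sedge_sym; case: uad => ->.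
have clique_bc : clique [set b; c].
  move=> u v; rewrite !inE => /orP[] /eqP-> /orP[] /eqP->; rewrite ?eqxx //.
  by rewrite sedge_sym.
(* By [typM] every vertex of [M] sees [x], which therefore joins the body. *)
have [/andP[xb xc]|xbc] := boolP (x -- b && x -- c).
  apply: (@spider_unip _ [set b; c; x] [set a; d] M) => //.
  - move=> v; rewrite !in_setU !in_set1 ?in_set0; move: (coverQ v).
    case: (v \in M); rewrite ?orbT //.
    by case/or4P=> [->|->|->|/or3P[->|->|]]; rewrite ?orbT.
  - exact: clique_set3.
  - exact: p3free_set2.
  - move=> u m; rewrite in_setU => /orP[ubc mM _|/set1P-> mM _]; first exact: bcM.
    by have := typM m mM; rewrite xb xc /= (sedge_sym m) !andbF; case: (x -- m).
have [/andP[xa xd]|xad] := boolP (x -- a && x -- d).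
  (* Neither branch of [typM] allows [x] to see both ends but not both midpoints, so the graph has
     only the five vertices of [Q]. *)
  have noM v : v \notin M.
    by apply/negP => /typM; move: xbc; rewrite xa xd; edge_cases.
  have cover5 v : [|| v == x, v == a, v == b, v == c | v == d].
    by have := coverQ v; rewrite (negbTE (noM v)) orbF.
  have split5 (K S : {set G}) : (forall v, (v \in K) || (v \in S)) ->
      clique K -> p3free S -> unip [set: G].
    move=> KS cK pS; apply: (@spider_unip _ K S set0) => //.
    + by move=> v; rewrite inE orbF.
    + by move=> u v _; rewrite inE.
    + by move=> u v _; rewrite inE.
  have [xb|xb] := boolP (x -- b).
    apply: (split5 [set a; b; x] [set c; d]); [|exact: clique_set3|exact: p3free_set2].
    move=> v; rewrite !inE; move: (cover5 v).
    by case/or3P=> [->|->|/or3P[->|->|->]]; rewrite ?orbT.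
  have [xc|xc] := boolP (x -- c).
    apply: (split5 [set c; d; x] [set a; b]); [|exact: clique_set3|exact: p3free_set2].
    move=> v; rewrite !inE; move: (cover5 v).
    by case/or3P=> [->|->|/or3P[->|->|->]]; rewrite ?orbT.
  (* Here [x] sees only the ends of the path and closes a C_5. *)
  exfalso; apply: (C5_free ab bc cd _ xa ac ad bd _ _); by rewrite sedge_sym.
(* If no vertex of [M] sees [x], then [x] joins the legs. *)
case: (pickP [pred m in M | m -- x]) => [m0 /andP[m0M m0x]|xM]; last first.
  apply: (@spider_unip _ [set b; c] [set a; d; x] M) => //.
  - move=> v; rewrite !in_setU !in_set1 ?in_set0; move: (coverQ v).
    case: (v \in M); rewrite ?orbT //.
    by case/or4P=> [->|->|->|/or3P[->|->|]]; rewrite ?orbT.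
  - exact: p3_adx.
  - by move=> u m ubc mM _; apply: bcM.
  - move=> u m; rewrite in_setU => /orP[uad|/set1P->] mM; first exact: MS.
    by have /negbT := xM m; rewrite /= mM (sedge_sym m).
(* The neighbourhood of [x] on the path is now [a], [c] or [b], [d], and in both cases [typM] makes
   all of [M] see [x]. *)
have xtype : [&& x -- a, ~~ (x -- b), x -- c & ~~ (x -- d)]
    || [&& ~~ (x -- a), x -- b, ~~ (x -- c) & x -- d].
  by have := typM m0 m0M; rewrite m0x (negbTE xbc).
have xM m : m \in M -> x -- m.
  move=> mM; have := typM m mM; rewrite (sedge_sym m); case: (x -- m) => //.
  by case/orP: xtype => /and4P[]; edge_cases.
(* The vertices [y], [x] against [z], [m], [m'] would form a K_{2,3}. Hence [M] is a clique and fits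
   in the body. *)
have no_stable_pair y z m m' : m \in M -> m' \in M -> m != m' -> ~~ (m -- m') ->
    y \in [set b; c] -> z \in [set a; d] -> x -- z -> y -- z -> ~~ (y -- x) -> False.
  move=> mM m'M nmm mm ybc zad xz yz yx.
  apply: (@K23_free y x z m m' _ _ yz) => //; try exact: xM; try exact: bcM; try exact: MS.
    by case/set2P: ybc => ->; rewrite eq_sym.
  have [mQ _ _ _ _] := MP m mM; have [m'Q _ _ _ _] := MP m' m'M.
  have zQ : z \in Q by case/set2P: zad => ->.
  by rewrite /= !inE negb_or nmm ![z == _]eq_sym !notQ.
have cliqueM : clique M.
  move=> m m' mM m'M nmm; apply: contraT => mm; exfalso.
  case/orP: xtype => /and4P[xa xb xc xd].
    by apply: (no_stable_pair b a m m'); rewrite ?set21 ?set22 // sedge_sym.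
  by apply: (no_stable_pair c d m m'); rewrite ?set21 ?set22 // sedge_sym.
apply: (@spider_unip _ ([set b; c] :|: M) [set a; d; x] set0) => //.
- move=> v; rewrite !in_setU !in_set1 ?in_set0; move: (coverQ v).
  case: (v \in M); rewrite ?orbT //.
  by case/or4P=> [->|->|->|/or3P[->|->|]]; rewrite ?orbT.
- move=> u v; rewrite ![_ \in _ :|: M]in_setU => /orP[ubc|uM] /orP[vbc|vM] nuv.
  + exact: clique_bc.
  + exact: bcM.
  + by rewrite sedge_sym bcM.
  + exact: cliqueM.
- exact: p3_adx.
- by move=> u v _; rewrite inE.
- by move=> u v _; rewrite inE.
Qed.

Lemma extendible_unip : P4_extendible G -> unip [set: G].
Proof.
move=> ext; case: p4_free_or_p4 => [|[a [b [c [d abcd]]]]]; first exact: p4_free_unip.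
case: (pickP [pred v | (v \notin [:: a; b; c; d]) && ~~ p4_type a b c d v]) => [x|typ].
  by case/andP; apply: extendible_partner_unip.
apply: (extendible_typed_unip ext abcd) => v vW.
by have := typ v; rewrite /= vW => /negbFE.
Qed.

End Main.

(** * The characterisation of minimal obstructions *)

Lemma sg_iso_dec (G H : sgraph) : sg_iso G H \/ ~ sg_iso G H.
Proof.
(* The search runs over finitely many functions; injectivity with the bound on cardinals expresses
   bijectivity as a Boolean. *)
case: (boolP [exists f : {ffun G -> H}, [&& injectiveb f, #|H| <= #|G| &
    [forall x, forall y, (f x -- f y) == (x -- y)]]]) => [|no].
  case/existsP=> f /and3P[/injectiveP injf leGH /forallP ef]; left; exists f.
    exact: inj_card_bij.
  by move=> x y; apply/eqP; move/forallP: (ef x).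
right=> -[f bijf ef]; case/existsP: no; exists (finfun f); apply/and3P; split.
- by apply/injectiveP => x y; rewrite !ffunE; apply: bij_inj.
- by rewrite (bij_eq_card bijf).
- by apply/forallP => x; apply/forallP => y; rewrite !ffunE ef.
Qed.

Theorem theorem52 (C : sgraph -> Prop)
    (C_iso : iso_closed C)
    (C_sub : (forall G : sgraph, C G -> P4_extendible G) \/
             (forall G : sgraph, C G -> P4_sparse G))
    (C_compl : compl_closed C)
    (C_her : hereditary C)
    (G : sgraph) (CG : C G) :
  minimal_unipolar_obstruction G <->
    (sg_iso G (copies 2 (path_graph 3)) \/
     sg_iso G (complete_bipartite 2 3) \/
     sg_iso G (cycle_graph 5)).
Proof.
split; last first.
  case=> [|[|]] /minimal_obstruction_of_iso; apply.
  - exact: two_path3_not_unipolar.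
  - exact: two_path3_delete_unip.
  - exact: biclique23_not_unipolar.
  - exact: biclique23_delete_unip.
  - exact: cycle5_not_unipolar.
  - exact: cycle5_delete_unip.
move=> minG; have [nuG properG] := minG.
have proper_unip (S : {set G}) v : v \notin S -> unip S.
  move=> vS; apply/unip_induced/properG/properP; split; first exact: subsetT.
  by exists v.
have [|n1] := sg_iso_dec G (copies 2 (path_graph 3)); first by left.
have [|n2] := sg_iso_dec G (complete_bipartite 2 3); first by right; left.
have [|n3] := sg_iso_dec G (cycle_graph 5); first by right; right.
have K23_free := minimal_biclique23_free minG n2.
have P3P3_free := minimal_two_path3_free minG n1.
(* With the three obstructions excluded, [G] itself is unipolar, a contradiction. *)
case: nuG; apply/unipolar_unip; case: C_sub => sub.
  exact: extendible_unip (minimal_cycle5_free minG n3) (sub _ CG).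
exact: sparse_unip (sub _ CG).
Qed.
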